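(* Let $\alpha\in(0,1)$, $\rho>0$, $a_1,a_2,a_3\in\mathbb{R}$, and let the fractional Lagrange function $L$ on $J^\alpha(\mathbb{R},\mathbb{R})$ be $L(t,x,y^{(\alpha)})=L_1(x,y^{(\alpha)})E_\alpha(-\rho t^\alpha)$ with $$L_1(x,y^{(\alpha)})=-a_1(y^{(\alpha)})^{2\alpha}-a_2(y^{(\alpha)})^\alpha x^\alpha-a_3x^{2\alpha}.$$ Then the fractional Euler–Lagrange equation of $L$ is $$a_1\Gamma(1+\alpha)\Gamma(1+2\alpha)\,y^{(2\alpha)}-\big(a_2\Gamma(1+\alpha)^2+\rho a_1\Gamma(1+2\alpha)\big)(y^{(\alpha)})^\alpha+a_2\Gamma(1+\alpha)^3\,y^{(\alpha)}-\big(a_3\Gamma(1+2\alpha)+\rho a_2\Gamma(1+\alpha)^2\big)x^\alpha=0.$$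
   Context: Caputo derivative: for $\beta\ge 0$ and $m\in\mathbb{N}^*$ with $m-1<\beta<m$, $D_t^\beta x(t)=\frac{1}{\Gamma(m-\beta)}\int_0^t\frac{x^{(m)}(s)}{(t-s)^{\beta+1-m}}ds$. For a function $f$ of several variables, the partial Caputo derivative of order $\alpha\in(0,1)$ in a variable $z$ is the Caputo derivative of order $\alpha$ with the other variables held fixed, with base point $0$: $D^\alpha_z f=\frac{1}{\Gamma(1-\alpha)}\int_0^z\frac{\partial f}{\partial z}(\dots,s,\dots)\frac{ds}{(z-s)^\alpha}$; thus $D_z^\alpha z^\gamma=\frac{\Gamma(1+\gamma)}{\Gamma(1+\gamma-\alpha)}z^{\gamma-\alpha}$ for $\gamma>0$. $E_\alpha(z)=\sum_{k=0}^\infty\frac{z^k}{\Gamma(1+\alpha k)}$ is the Mittag-Leffler function, so that $D_t^\alpha E_\alpha(-\rho t^\alpha)=-\rho E_\alpha(-\rho t^\alpha)$; $\rho$ is the discount rate. $J^\alpha(\mathbb{R},\mathbb{R})$ is the fractional jet bundle with coordinates $(t,x,y^{(\alpha)})$. Along a curve $x(t)$, $y^{(\alpha)}=\frac{1}{\Gamma(1+\alpha)}D_t^\alpha x$ and $y^{(2\alpha)}=\frac{1}{\Gamma(1+2\alpha)}D_t^{2\alpha}x$. Note that $(y^{(\alpha)})^{\alpha}$ and $(y^{(\alpha)})^{2\alpha}$ are powers of $y^{(\alpha)}$, whereas $y^{(2\alpha)}$ is a different coordinate. The fractional Euler–Lagrange equation of a fractional Lagrange function $L(t,x,y^{(\alpha)})$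 is $D^\alpha_{x}L-d_t^{2\alpha}(D^\alpha_{y^{(\alpha)}}L)=0$, where $d_t^{2\alpha}=D_t^\alpha+y^{(\alpha)}D^\alpha_{x}+y^{(2\alpha)}D^\alpha_{y^{(\alpha)}}$. *)

(* Defs.v *)
From mathcomp Require Export all_boot all_order all_algebra.
From mathcomp Require Export all_classical all_reals all_analysis.
Export Order.TTheory GRing.Theory Num.Theory.
Export numFieldNormedType.Exports.

Set Implicit Arguments.
Unset Strict Implicit.
Unset Printing Implicit Defensive.

Local Open Scope classical_set_scope.
Local Open Scope ring_scope.

(* Only meaningful for 0 < x, where the integral converges. *)
Definition Gamma (R : realType) (x : R) : R :=
  \int[lebesgue_measure]_(s in `]0, +oo[) (s `^ (x - 1) * expR (- s)).

(* Caputo derivative of order alpha in ]0, 1[ with base point 0, at z > 0.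
   The integral is over the open interval since the kernel is singular at z
   and f need not be differentiable at 0 (e.g. z `^ alpha). *)
Definition caputo (R : realType) (alpha : R) (f : R -> R) (z : R) : R :=
  (Gamma (1 - alpha))^-1 *
  \int[lebesgue_measure]_(s in `]0, z[) (derive1 f s / (z - s) `^ alpha).

Definition mittag_leffler (R : realType) (alpha z : R) : R :=
  limn (series (fun k : nat => z ^+ k / Gamma (1 + alpha * k%:R))).

(* Functions on the jet bundle are written in the coordinates (t, x, y), with y
   standing for y^(alpha); y2 below is the further coordinate y^(2 alpha). *)
Section JetBundle.
Context {R : realType}.
Implicit Types (alpha t x y : R) (F L : R -> R -> R -> R).

Definition caputo_t alpha F t x y : R := caputo alpha (fun s => F s x y) t.
Definition caputo_x alpha F t x y : R := caputo alpha (fun s => F t s y) x.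
Definition caputo_y alpha F t x y : R := caputo alpha (fun s => F t x s) y.

Definition total_caputo alpha F t x y (y2 : R) : R :=
  caputo_t alpha F t x y + y * caputo_x alpha F t x y
  + y2 * caputo_y alpha F t x y.

Definition euler_lagrange alpha L t x y (y2 : R) : R :=
  caputo_x alpha L t x y - total_caputo alpha (caputo_y alpha L) t x y y2.

End JetBundle.

(* Main.v *)
Require Import Defs.
From mathcomp Require Import measurable_realfun.
From mathcomp Require Import ring lra.

(** In the variables [x] and [y], [L] is a combination of a constant, an
    [alpha]-th power and a [(2 alpha)]-th power, and so is its Caputo derivative
    in [y]; in [t] it is a multiple of
    [M t := mittag_leffler alpha (- rho * t `^ alpha)].  Hence every derivative
    in the Euler-Lagrange expression is given by the rule for powers
    ([caputo_two_powers]) or by the eigenfunction equation of [M]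
    ([caputo_ml]), and the expression turns out to be the left-hand side of the
    stated equation multiplied by [M t / Gamma (1 + alpha)].  What remains is
    that this factor does not vanish, that is, [M t != 0] ([ml_gt0]).

    The rule for powers is Euler's Beta integral
    [Gamma a * Gamma b = B(a, b) * Gamma (a + b)]: the product of the two Gamma
    integrals is an integral over a quadrant, which Tonelli's theorem lets one
    slice along [s + r = z] ([egammaM]).  All integrands are nonnegative, so the
    identity is first proved in the extended reals; with [b = 1], where
    [B(a, 1) = 1 / a], it then yields the finiteness of Gamma for small arguments
    and the functional equation.

    The bound [M ^ x * exp (- M) <= Gamma (1 + x)], for every [M > 0], makes the
    Mittag-Leffler series entire.  It may therefore be differentiated term by
    term; integrating the result against [(z - s) ^ (- alpha)] term by term is
    dominated convergence, with a multiple of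
    [s ^ (alpha - 1) * (z - s) ^ (- alpha)] as the dominating function
    ([ml_kernel_integral]).

    For the positivity, let [x1] be a point of [[0, x]] at which
    [w |-> E_alpha (- w)] is minimal, and suppose that the minimum [m] is at most
    [0].  Then [x1 > 0], as [E_alpha 0 = 1].  The function
    [u s := E_alpha (- x1 * s ^ alpha)] is minimal on [[0, 1]] at [s = 1], with
    [u 1 = m < u 0], and at a minimum that is not the initial value the Caputo
    derivative is negative ([extremum_principle]).  But it equals
    [- x1 * u 1 = - x1 * m >= 0]. *)

Set Implicit Arguments.
Unset Strict Implicit.
Unset Printing Implicit Defensive.

Local Open Scope ring_scope.

(** * The Gamma function and the Beta integral *)

Section GammaBeta.
Local Open Scope classical_set_scope.
Local Open Scope ring_scope.
Context {R : realType}.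
Local Notation mu := (@lebesgue_measure R).
Implicit Types (a b c d s x z : R).

(** Two measures that agree on half-open intervals are equal, and the image of
    Lebesgue measure under an affine map scales the length of intervals. *)
Lemma ge0_integral_affine c d (f : R -> \bar R) : 0 < c ->
  measurable_fun [set: R] f -> (forall x, 0 <= f x)%E ->
  (\int[mu]_x f x = c%:E * \int[mu]_x f (c * x + d)%R)%E.
Proof.
move=> c0 mf f0.
pose phi : measurableTypeR R -> measurableTypeR R := fun x => c * x + d.
have mphi : measurable_fun setT phi.
  by apply: measurable_funD => //; exact: measurable_funM.
pose p := measure_function_pushforward__canonical__measure_function_Measure mu mphi.
pose m := mscale (NngNum (ltW c0)) p.
have mE A : measurable A -> mu A = m A.
  apply: lebesgue_measure_unique => _ [[u v]] _ <-.
  change (mu `]u, v] = c%:E * mu (phi @^-1` `]u, v]))%E.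
  have -> : phi @^-1` `]u, v] = `](u - d) / c, (v - d) / c]%classic.
    apply/seteqP; split => x; rewrite /phi /= !in_itv/=;
      by rewrite ltr_pdivrMr// ler_pdivlMr// ltrBlDr lerBrDr mulrC.
  rewrite !lebesgue_measure_itv /= !lte_fin ltr_pM2r ?invr_gt0// ltrD2r.
  case: ifPn => _; last by rewrite mule0.
  by rewrite -!EFinD -EFinM; congr EFin; field; rewrite gt_eqF.
transitivity (\int[m]_x f x)%E.
  by apply: eq_measure_integral => A mA _; exact: mE.
rewrite ge0_integral_mscale//; congr (_ * _)%E.
by rewrite ge0_integral_pushforward.
Qed.

(** Extending the power by [0] to nonpositive arguments turns integrals over
    [`]0, +oo[] and [`]0, z[] into integrals over the whole line, where
    substitution and Tonelli's theorem need no bookkeeping of domains. *)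
Definition tpow a s : R := if 0 < s then s `^ (a - 1) else 0.

Lemma tpow_ge0 a s : 0 <= tpow a s.
Proof. by rewrite /tpow; case: ifP => // _; exact: powR_ge0. Qed.

Lemma measurable_tpow a : measurable_fun [set: R] (tpow a).
Proof.
apply: measurable_fun_ifT => //; first exact: measurable_fun_ltr.
Qed.

(** The extended-real forms of Gamma and Beta make sense before anything is
    known to be integrable. *)
Definition egamma a : \bar R := (\int[mu]_s (tpow a s * expR (- s))%:E)%E.
Definition ebeta a b : \bar R := (\int[mu]_s (tpow a s * tpow b (1 - s))%:E)%E.

Lemma tpowM a c s : 0 < c -> tpow a (c * s) = c `^ (a - 1) * tpow a s.
Proof.
move=> c0; rewrite /tpow pmulr_rgt0//; case: ifPn => s0; last by rewrite mulr0.
by rewrite powRM// ltW.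
Qed.

Let mtpow_comp a (g : R -> R) : measurable_fun [set: R] g ->
  measurable_fun [set: R] (fun x => tpow a (g x)).
Proof. by move=> mg; exact: (measurableT_comp (measurable_tpow a)). Qed.

(** The substitution [s = z * r] scales the convolution to [z = 1]. *)
Lemma tpow_convolution a b z :
  (\int[mu]_s (tpow a s * tpow b (z - s))%:E = (tpow (a + b) z)%:E * ebeta a b)%E.
Proof.
have [z0|z0] := ltP 0 z; last first.
  rewrite [tpow (a + b) z]/tpow ltNge z0/= mul0e integral0_eq// => s _.
  rewrite /tpow; case: ifPn => s0; last by rewrite mul0r.
  by rewrite ifF ?mulr0//; apply/negbTE; rewrite -leNgt; lra.
rewrite (@ge0_integral_affine z 0 _ z0); last 2 first.
  apply/measurable_EFinP/measurable_funM; first exact: measurable_tpow.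
  by apply: mtpow_comp; exact: measurable_funB.
  by move=> x; rewrite lee_fin mulr_ge0// tpow_ge0.
under eq_integral => s _.
  rewrite addr0 (_ : z - z * s = z * (1 - s)); last by ring.
  rewrite !tpowM// mulrACA EFinM.
  over.
rewrite ge0_integralZl//; last 3 first.
  apply/measurable_EFinP/measurable_funM; first exact: measurable_tpow.
  by apply: mtpow_comp; exact: measurable_funB.
  by move=> x _; rewrite lee_fin mulr_ge0// tpow_ge0.
  by rewrite lee_fin mulr_ge0// powR_ge0.
rewrite muleA -EFinM -/(ebeta a b); congr (_%:E * _)%E.
rewrite /tpow z0 -[X in X * _](powRr1 (ltW z0)) -!powRD.
- by congr (_ `^ _); ring.
- by rewrite (gt_eqF z0) implybT.
- by rewrite (gt_eqF z0) implybT.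
Qed.

Lemma egamma_ge0 a : (0 <= egamma a)%E.
Proof. by apply: integral_ge0 => s _; rewrite lee_fin mulr_ge0 ?tpow_ge0 ?expR_ge0. Qed.

Lemma ebeta_ge0 a b : (0 <= ebeta a b)%E.
Proof. by apply: integral_ge0 => s _; rewrite lee_fin mulr_ge0 ?tpow_ge0. Qed.

Let mexpN : measurable_fun [set: R] (fun s : R => expR (- s)).
Proof. by apply: measurableT_comp => //; exact: measurable_expR. Qed.

Lemma egamma_shift b s :
  egamma b = (\int[mu]_z (tpow b (z - s) * expR (- (z - s)))%:E)%E.
Proof.
rewrite /egamma (@ge0_integral_affine 1 (- s) _ ltr01).
- by rewrite mul1e; apply: eq_integral => z _; rewrite mul1r.
- apply/measurable_EFinP/measurable_funM => //; exact: measurable_tpow.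
- by move=> x; rewrite lee_fin mulr_ge0 ?tpow_ge0 ?expR_ge0.
Qed.

(** Euler's identity.  In the double integral over [s] and [r] one substitutes
    [r = z - s]; for fixed [z] the exponentials combine to [expR (- z)], and the
    inner integral is the convolution of the two truncated powers. *)
Lemma egammaM a b : (egamma a * egamma b = ebeta a b * egamma (a + b))%E.
Proof.
pose K (p : R * R) : \bar R := (tpow a p.1 * tpow b (p.2 - p.1) * expR (- p.2))%:E.
have mK : measurable_fun setT K.
  apply/measurable_EFinP; apply: measurable_funM; last first.
    by apply: (measurableT_comp mexpN); exact: measurable_snd.
  apply: measurable_funM; first by apply: (measurableT_comp (measurable_tpow a)).
  apply: (measurableT_comp (measurable_tpow b)); exact: measurable_funB.
have K0 p : (0 <= K p)%E by rewrite lee_fin !mulr_ge0 ?tpow_ge0 ?expR_ge0.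
transitivity (\int[mu]_s \int[mu]_z K (s, z))%E.
  rewrite [X in (X * _)%E]/egamma -ge0_integralZr//; last 3 first.
    by apply/measurable_EFinP/measurable_funM => //; exact: measurable_tpow.
    by move=> x _; rewrite lee_fin mulr_ge0 ?tpow_ge0 ?expR_ge0.
    exact: egamma_ge0.
  apply: eq_integral => s _; rewrite (egamma_shift b s) -ge0_integralZl//.
  - apply: eq_integral => z _; rewrite -EFinM /K/=; congr EFin.
    rewrite opprB expRD expRN; field; exact: lt0r_neq0 (expR_gt0 _).
  - apply/measurable_EFinP/measurable_funM.
      by apply: mtpow_comp; exact: measurable_funB.
    by apply: (measurableT_comp mexpN); exact: measurable_funB.
  - by move=> x _; rewrite lee_fin mulr_ge0 ?tpow_ge0 ?expR_ge0.
  - by rewrite lee_fin mulr_ge0 ?tpow_ge0 ?expR_ge0.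
transitivity (\int[mu]_z \int[mu]_s K (s, z))%E.
  exact: (@fubini_tonelli _ _ _ _ R mu mu K mK K0).
rewrite [in RHS]/egamma -ge0_integralZl//; last 3 first.
  by apply/measurable_EFinP/measurable_funM => //; exact: measurable_tpow.
  by move=> x _; rewrite lee_fin mulr_ge0 ?tpow_ge0 ?expR_ge0.
  exact: ebeta_ge0.
apply: eq_integral => z _; rewrite EFinM muleA [(ebeta a b * _)%E]muleC.
rewrite -tpow_convolution -ge0_integralZr//.
- apply/measurable_EFinP/measurable_funM; first exact: measurable_tpow.
  by apply: mtpow_comp; exact: measurable_funB.
- by move=> x _; rewrite lee_fin mulr_ge0 ?tpow_ge0.
Qed.

Lemma continuous_powR a s : 0 < s -> {for s, continuous (fun x => x `^ a)}.
Proof.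
move=> s0; apply/differentiable_continuous/derivable1_diffP.
by apply: derivable_powR; rewrite in_itv/= andbT.
Qed.

(** The primitive [s `^ a / a] may fail to be differentiable at [0], so the
    integral is the monotone limit of the integrals over [[1 / (i + 2), 1]]. *)
Lemma ebeta1r a : 0 < a -> ebeta a 1 = (a^-1)%:E.
Proof.
move=> a0.
transitivity (\int[mu]_(s in `]0%R, 1%R[) (s `^ (a - 1))%:E)%E.
  rewrite [RHS]integral_mkcond; apply: eq_integral => s _.
  rewrite patchE /tpow mem_setE in_itv/= subr_gt0.
  by case: ifPn; case: ifPn => //= _ _; rewrite ?mul0r ?mulr0// subrr powRr0 mulr1.
have mpow (D : set R) : measurable_fun D (fun s : R => (s `^ (a - 1))%:E).
  by apply/measurable_EFinP/measurable_funTS.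
rewrite integral_itv_bndo_bndc//.
pose F (i : nat) : set R := `[(i.+2%:R : R)^-1, 1]%classic.
have FE : (\bigcup_i F i) = `]0, 1]%classic.
  apply/seteqP; split => [x [i _]|x]; rewrite /F /= !in_itv/=.
    by move=> /andP[ix ->]; rewrite andbT (lt_le_trans _ ix)// invr_gt0.
  move=> /andP[x0 x1]; exists (Num.truncn x^-1) => //; rewrite /= in_itv/= x1 andbT.
  rewrite -[leRHS]invrK lef_pV2 ?posrE ?invr_gt0//.
  by rewrite ltW// (lt_trans (truncnS_gt _))// ltr_nat.
rewrite -FE.
have : (\int[mu]_(s in F i) (s `^ (a - 1))%:E @[i --> \oo] -->
    \int[mu]_(s in \bigcup_i F i) (s `^ (a - 1))%:E)%E.
  apply: ge0_nondecreasing_set_cvg_integral => //.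
  - move=> m n mn; apply/subsetPset => x; rewrite /F /= !in_itv/= => /andP[xm ->].
    by rewrite andbT (le_trans _ xm)// lef_pV2 ?posrE// ler_nat.
  - by move=> i; rewrite /F; apply: measurable_itv.
  - by move=> i; apply: mpow.
  - by move=> i s _; rewrite lee_fin powR_ge0.
have F0 i : 0 < (i.+2%:R : R)^-1 by rewrite invr_gt0.
have intF i : (\int[mu]_(s in F i) (s `^ (a - 1))%:E =
    (a^-1 * 1 `^ a)%:E - (a^-1 * (i.+2%:R)^-1 `^ a)%:E)%E.
  apply: (@continuous_FTC2 _ _ (fun s => a^-1 * s `^ a)).
  - by rewrite invf_lt1// ltr1n.
  - apply: continuous_in_subspaceT => s; rewrite inE/= in_itv/=.
    move=> /andP[/(lt_le_trans (F0 i)) s0 _].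
    exact: continuous_powR.
  - have c u : 0 < u -> {for u, continuous (fun s => a^-1 * s `^ a)}.
      by move=> u0; apply: continuousM; [exact: cvg_cst|exact: continuous_powR].
    split.
    + move=> s; rewrite in_itv/= => /andP[/(lt_trans (F0 i)) s0 _].
      by apply: derivableM => //; apply: derivable_powR; rewrite in_itv/= andbT.
    + by apply: cvg_at_right_filter; exact: c.
    + by apply: cvg_at_left_filter; exact: c.
  - move=> s; rewrite in_itv/= => /andP[/(lt_trans (F0 i)) s0 _].
    rewrite derive1Ml; last by apply: derivable_powR; rewrite in_itv/= andbT.
    by rewrite powR_derive1 ?in_itv/= ?andbT// mulrA mulVf ?mul1r// gt_eqF.
under eq_fun do rewrite intF.
move=> /cvg_unique; apply => //.
rewrite powR1 mulr1.
apply: cvg_EFin => /=.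
  by apply: nearW.
rewrite -[X in _ --> X]subr0; apply: cvgB; first exact: cvg_cst.
rewrite -(mulr0 a^-1); apply: cvgM; first exact: cvg_cst.
have /cvg_at_rightP := powR_cvg0 a0; apply; split => //.
have := @cvg_harmonic R; rewrite -cvg_shiftS; exact.
Qed.

Lemma egamma1 : egamma 1 = 1%E :> \bar R.
Proof.
transitivity (\int[mu]_(s in `]0%R, +oo[) (exponential_pdf 1 s)%:E)%E.
  rewrite [RHS]integral_mkcond; apply: eq_integral => s _.
  rewrite patchE /tpow mem_setE in_itv/= andbT; case: ifPn => s0; last by rewrite mul0r.
  by rewrite subrr powRr0 exponential_pdfE ?ltW// !mul1r mulN1r.
have mp : measurable_fun [set: R] (fun s : R => (exponential_pdf 1 s)%:E).
  by apply/measurable_EFinP; exact: measurable_exponential_pdf.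
rewrite integral_itv_obnd_cbnd//; last exact: measurable_funTS.
rewrite -(@integral_exponential_pdf R 1 ltr01) [LHS]integral_mkcond.
apply: eq_integral => s _; rewrite patchE mem_setE in_itv/= andbT.
by case: ifPn => //; rewrite -ltNge => s0; rewrite lt0_exponential_pdf.
Qed.

(** Keep only the part of the Gamma integral over [s > M], where [s `^ x] is at
    least [M `^ x]; there [expR (- s)] integrates to [expR (- M)]. *)
Lemma egamma_lb x M : 0 <= x -> 0 < M ->
  ((M `^ x * expR (- M))%:E <= egamma (1 + x))%E.
Proof.
move=> x0 M0; rewrite -[leLHS]mule1 -egamma1 (egamma_shift 1 M).
rewrite -ge0_integralZl//; last 3 first.
- apply/measurable_EFinP/measurable_funM.
    by apply: (measurableT_comp (measurable_tpow 1)); exact: measurable_funB.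
  by apply: measurableT_comp => //; apply: measurableT_comp => //; exact: measurable_funB.
- by move=> s _; rewrite lee_fin mulr_ge0 ?tpow_ge0 ?expR_ge0.
- by rewrite lee_fin mulr_ge0 ?powR_ge0 ?expR_ge0.
apply: ge0_le_integral => //.
- by move=> s _; rewrite lee_fin !mulr_ge0 ?tpow_ge0 ?expR_ge0 ?powR_ge0.
- apply/measurable_EFinP/measurable_funM => //; apply/measurable_funM.
    by apply: (measurableT_comp (measurable_tpow 1)); exact: measurable_funB.
  by apply: measurableT_comp => //; apply: measurableT_comp => //; exact: measurable_funB.
- by apply/measurable_EFinP/measurable_funM => //; exact: measurable_tpow.
move=> s _; rewrite -EFinM lee_fin /tpow subr_gt0; case: ifPn => [Ms|_]; last first.
  by rewrite mul0r mulr0; case: ifPn => _; rewrite ?mul0r// mulr_ge0 ?powR_ge0 ?expR_ge0.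
rewrite (lt_trans M0 Ms) subrr powRr0 mul1r -mulrA -expRD ler_pM ?powR_ge0 ?expR_ge0//.
  rewrite (_ : 1 + x - 1 = x); last by ring.
  by apply: ge0_ler_powR => //; rewrite ?nnegrE ltW//; exact: lt_trans Ms.
by rewrite ler_expR; lra.
Qed.

(** [x * ln s <= s / 2 + x * ln (2 * x)] bounds the integrand by a multiple of
    the exponential density of rate [1 / 2]. *)
Lemma egammaS_lty x : 0 < x -> (egamma (1 + x) < +oo)%E.
Proof.
move=> x0; pose C := expR (x * ln (2 * x)) * 2.
have C0 : 0 <= C by rewrite mulr_ge0 ?expR_ge0.
apply: (@le_lt_trans _ _ (\int[mu]_s (C%:E * (exponential_pdf 2^-1 s)%:E))%E); last first.
  rewrite ge0_integralZl//.
  - by rewrite integral_exponential_pdf ?invr_gt0// mule1 ltry.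
  - by apply/measurable_EFinP; exact: measurable_exponential_pdf.
  - by move=> s _; rewrite lee_fin exponential_pdf_ge0.
apply: ge0_le_integral => //.
- by move=> s _; rewrite lee_fin mulr_ge0 ?tpow_ge0 ?expR_ge0.
- by apply/measurable_EFinP/measurable_funM => //; exact: measurable_tpow.
- by apply/measurable_EFinP/measurable_funM => //; exact: measurable_exponential_pdf.
move=> s _; rewrite -EFinM lee_fin /tpow; case: ifPn => s0; last first.
  by rewrite mul0r mulr_ge0// exponential_pdf_ge0.
rewrite (exponential_pdfE _ (ltW s0)) /C -mulrA mulVKf//.
rewrite (_ : 1 + x - 1 = x); last by ring.
rewrite /powR gt_eqF//. rewrite -!expRD ler_expR.
have x2 : 0 < 2 * x by rewrite mulr_gt0.
have /ln_sublinear : 0 < s / (2 * x) by rewrite divr_gt0.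
rewrite ln_div ?posrE// ltrBlDr -(ltr_pM2l x0) => /ltW /le_trans h.
rewrite -lerBrDr; apply: h; rewrite mulrDr.
rewrite [leLHS](_ : _ = s / 2 + x * ln (2 * x)); last by field; rewrite gt_eqF.
lra.
Qed.

(** Euler's identity with [b = 1] reads [egamma a = egamma (a + 1) / a] and
    reduces the singular case [a < 1] to [egammaS_lty]. *)
Lemma egamma_fin_num a : 0 < a -> egamma a \is a fin_num.
Proof.
move=> a0; rewrite ge0_fin_numE ?egamma_ge0// -[egamma a]mule1 -egamma1.
rewrite egammaM ebeta1r// [a + 1]addrC.
by rewrite lte_mul_pinfty// ?lee_fin ?invr_ge0 ?(ltW a0)// egammaS_lty.
Qed.

Lemma GammaE a : 0 < a -> egamma a = (Gamma a)%:E.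
Proof.
move=> a0; rewrite -[LHS]fineK ?egamma_fin_num//; congr (fine _)%:E.
rewrite [RHS]integral_mkcond; apply: eq_integral => s _.
by rewrite patchE /tpow mem_setE in_itv/= andbT; case: ifPn => //; rewrite mul0r.
Qed.

Lemma Gamma1 : Gamma 1 = 1 :> R.
Proof. by apply: EFin_inj; rewrite -GammaE// egamma1. Qed.

Lemma GammaS a : 0 < a -> Gamma (1 + a) = a * Gamma a.
Proof.
move=> a0; have := egammaM a 1.
rewrite egamma1 mule1 ebeta1r// [a + 1]addrC !GammaE ?addr_gt0//.
by rewrite -EFinM => -[->]; rewrite mulrA divff ?gt_eqF// mul1r.
Qed.

Lemma Gamma_lb x M : 0 <= x -> 0 < M -> M `^ x * expR (- M) <= Gamma (1 + x).
Proof. by move=> x0 M0; rewrite -lee_fin -GammaE ?egamma_lb// ltr_wpDr. Qed.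

Lemma Gamma_gt0 a : 0 < a -> 0 < Gamma a.
Proof.
move=> a0; rewrite -(pmulr_rgt0 _ a0) -GammaS//.
by apply: lt_le_trans (Gamma_lb (ltW a0) ltr01); rewrite powR1 mul1r expR_gt0.
Qed.

Definition Beta a b : R := Gamma a * Gamma b / Gamma (a + b).

Lemma ebetaE a b : 0 < a -> 0 < b -> ebeta a b = (Beta a b)%:E.
Proof.
move=> a0 b0; have ab0 : 0 < a + b by exact: addr_gt0.
have := egammaM a b; rewrite !GammaE// => h.
have : (ebeta a b * (Gamma (a + b))%:E * (Gamma (a + b))^-1%:E =
    (Beta a b)%:E)%E by rewrite -h.
by rewrite -muleA -EFinM divff ?mule1// gt_eqF// Gamma_gt0.
Qed.

Lemma integral_power_kernel a b z : 0 < a -> 0 < b -> 0 < z ->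
  (\int[mu]_(s in `]0%R, z[) (s `^ (a - 1) * (z - s) `^ (b - 1))%:E
   = (Beta a b * z `^ (a + b - 1))%:E)%E.
Proof.
move=> a0 b0 z0; rewrite mulrC EFinM -ebetaE//.
have := tpow_convolution a b z; rewrite [tpow (a + b) z]/tpow z0 => <-.
rewrite integral_mkcond; apply: eq_integral => s _.
rewrite patchE /tpow mem_setE in_itv/= subr_gt0.
by case: (ltP 0 s); case: (ltP s z) => _ _ /=; rewrite ?mul0r ?mulr0.
Qed.

Lemma integrable_power_kernel a b z : 0 < a -> 0 < b -> 0 < z ->
  mu.-integrable `]0, z[ (fun s => (s `^ (a - 1) * (z - s) `^ (b - 1))%:E).
Proof.
move=> a0 b0 z0; apply/integrableP; split.
  apply/measurable_EFinP/measurable_funTS/measurable_funM => //.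
  by apply: (measurableT_comp (measurable_powR _)); exact: measurable_funB.
under eq_integral => s _ do rewrite gee0_abs ?lee_fin ?mulr_ge0 ?powR_ge0//.
by rewrite integral_power_kernel// ltry.
Qed.

End GammaBeta.

(** * The Mittag-Leffler series *)

Section MittagLeffler.
Local Open Scope classical_set_scope.
Local Open Scope ring_scope.
Context {R : realType}.
Implicit Types (alpha rho s x z K : R) (c : R^nat).

Definition entire c := forall K, cvgn (pseries c K).

Lemma entire_normed c K : entire c -> cvgn (pseries (fun i => `|c i|) K).
Proof.
move=> ec; apply: (is_cvg_pseries_inside_norm (ec (`|K| + 1))).
by rewrite [ltRHS]ger0_norm ?addr_ge0// ltrDl.
Qed.

(** The factor [k + 1] produced by differentiation is at most [2 ^ (k + 1)], so
    it is absorbed by evaluating the normed series at [2 * (`|K| + 1)]. *)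
Lemma entire_diffs c : entire c -> entire (pseries_diffs c).
Proof.
move=> ec K; pose W := 2 * (`|K| + 1).
have K1 : 1 <= `|K| + 1 by rewrite lerDr.
pose v k := `|c k.+1| * W ^+ k.+1.
apply: normed_cvg; apply: (@series_le_cvg _ _ v) => [n|n|n|] //=.
- by rewrite /v mulr_ge0// exprn_ge0// mulr_ge0// (le_trans ler01 K1).
- rewrite normrM normrX /pseries_diffs normrM normr_nat /v mulrAC mulrC.
  rewrite ler_wpM2l// /W exprMn ler_pM//.
    by rewrite -natrX ler_nat ltnW// ltn_expl.
  rewrite exprS -[leLHS]mul1r ler_pM// ?exprn_ge0//.
  rewrite lerXn2r// ?nnegrE ?(le_trans ler01 K1)//.
  by rewrite lerDl.
have cW := entire_normed (K := W) ec.
rewrite (_ : series v = fun n => pseries (fun i => `|c i|) W n.+1 - `|c 0|).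
  apply: is_cvgB; last exact: is_cvg_cst.
  by move/cvg_ex: cW => [l cl]; apply/cvg_ex; exists l; move: cl; rewrite -cvg_shiftS.
apply/funext => n; rewrite /pseries /series /= big_nat_recl//= expr0 mulr1.
by rewrite addrC addKr.
Qed.

Lemma entire_derive c x : entire c ->
  is_derive x 1 (fun w => limn (pseries c w)) (limn (pseries (pseries_diffs c) x)).
Proof.
move=> ec; apply: (@pseries_snd_diffs _ _ (`|x| + 1)).
- exact: ec.
- exact: entire_diffs.
- by do 2 apply: entire_diffs.
- by rewrite [ltRHS]ger0_norm ?addr_ge0// ltrDl.
Qed.

Definition ml_coeff alpha : R^nat := fun k => (Gamma (1 + alpha * k%:R))^-1.

Lemma mittag_lefflerE alpha z :
  mittag_leffler alpha z = limn (pseries (ml_coeff alpha) z).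
Proof.
rewrite /mittag_leffler /pseries; congr (limn (series _)).
by apply/funext => k; rewrite mulrC.
Qed.

(** With [M `^ alpha = W], [Gamma_lb] bounds the [k]-th coefficient by
    [expR M / W ^+ k]; as [W] is free, the series is dominated by a geometric
    one at any given point. *)
Lemma entire_ml alpha : 0 < alpha -> entire (ml_coeff alpha).
Proof.
move=> a0 K; pose W := 2 * (`|K| + 1); pose M := W `^ alpha^-1.
have W0 : 0 < W by rewrite mulr_gt0// ltr_wpDl.
have M0 : 0 < M by exact: powR_gt0.
apply: normed_cvg.
apply: (@series_le_cvg _ _ (geometric (expR M) (`|K| / W))) => [n|n|n|] //=.
- by rewrite mulr_ge0 ?expR_ge0// exprn_ge0// divr_ge0// ltW.
- have ak0 : 0 <= alpha * n%:R by rewrite mulr_ge0// ltW.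
  have G0 : 0 < Gamma (1 + alpha * n%:R) by rewrite Gamma_gt0// ltr_wpDr.
  rewrite normrM normrX /ml_coeff ger0_norm ?invr_ge0 ?(ltW G0)//.
  rewrite expr_div_n [leRHS]mulrA [leRHS]mulrAC ler_wpM2r ?exprn_ge0//.
  rewrite -[expR M]invrK -expRN -invfM lef_pV2 ?posrE ?mulr_gt0 ?exprn_gt0 ?expR_gt0//.
  apply: le_trans (Gamma_lb ak0 M0).
  have MW : M `^ alpha = W by rewrite /M -powRrM mulVf ?gt_eqF// powRr1// ltW.
  by rewrite powRrM MW powR_mulrn ?(ltW W0)// mulrC.
apply: is_cvg_geometric_series; rewrite ger0_norm ?divr_ge0 ?(ltW W0)//.
by rewrite ltr_pdivrMr// mul1r /W; have := normr_ge0 K; lra.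
Qed.

Definition ml_deriv alpha z : R :=
  limn (pseries (pseries_diffs (ml_coeff alpha)) z).

Lemma is_derive_ml alpha x : 0 < alpha ->
  is_derive x 1 (mittag_leffler alpha) (ml_deriv alpha x).
Proof.
move=> a0.
rewrite (_ : mittag_leffler alpha = fun w => limn (pseries (ml_coeff alpha) w)).
  exact/entire_derive/entire_ml.
by apply/funext => w; exact: mittag_lefflerE.
Qed.

Definition ml_powR_deriv alpha rho s : R :=
  ml_deriv alpha (- rho * s `^ alpha) * (- rho * (alpha * s `^ (alpha - 1))).

Lemma is_derive_ml_powR alpha rho s : 0 < alpha -> 0 < s ->
  is_derive s 1 (fun s => mittag_leffler alpha (- rho * s `^ alpha))
    (ml_powR_deriv alpha rho s).
Proof.
move=> a0 s0.
apply: (@is_derive1_comp _ (mittag_leffler alpha) (fun s => - rho * s `^ alpha)).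
  exact: is_derive_ml.
by have h := is_derive1_powR alpha s0; exact: is_deriveZ.
Qed.

Lemma ml0 alpha : 0 < alpha -> mittag_leffler alpha 0 = 1.
Proof.
move=> a0; apply/cvg_lim => //; rewrite -cvg_shiftS.
rewrite (_ : [sequence _]_n = cst 1); first exact: cvg_cst.
apply/funext => n; rewrite /series /= big_nat_recl//=.
rewrite expr0 mulr0 addr0 Gamma1 invr1 mulr1.
by rewrite big1 ?addr0// => i _; rewrite expr0n mul0r.
Qed.

End MittagLeffler.

(** * Caputo derivatives of powers and of the Mittag-Leffler function *)

Section Caputo.
Local Open Scope classical_set_scope.
Local Open Scope ring_scope.
Context {R : realType}.
Local Notation mu := (@lebesgue_measure R).
Implicit Types (alpha rho s x z : R).

(** Serves both the Lagrangian, with two terms, and the partial sums of the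
    Mittag-Leffler series. *)
Lemma integral_powsum alpha z n (d g : nat -> R) : 0 < alpha < 1 -> 0 < z ->
  (forall k, 0 < g k) ->
  mu.-integrable `]0, z[
     (fun s => ((\sum_(0 <= k < n) d k * s `^ (g k - 1)) / (z - s) `^ alpha)%:E) /\
  \int[mu]_(s in `]0, z[)
     ((\sum_(0 <= k < n) d k * s `^ (g k - 1)) / (z - s) `^ alpha)
  = Gamma (1 - alpha) * \sum_(0 <= k < n)
      d k * (Gamma (g k) / Gamma (g k + 1 - alpha) * z `^ (g k - alpha)).
Proof.
move=> /andP[a0 a1] z0 g0.
have a1' : 0 < 1 - alpha by rewrite subr_gt0.
have kE s k : s `^ (g k - 1) / (z - s) `^ alpha =
    s `^ (g k - 1) * (z - s) `^ (1 - alpha - 1).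
  by rewrite -powRN; congr (_ * _ `^ _); ring.
elim: n => [|n [IHi IHe]].
  rewrite big_nil mulr0.
  have E0 s : (\sum_(0 <= k < 0) d k * s `^ (g k - 1)) / (z - s) `^ alpha = 0.
    by rewrite big_nil mul0r.
  split; first by apply: eq_integrable (integrable0 _ _) => // s _; rewrite E0.
  under eq_Rintegral => s _ do rewrite E0.
  by rewrite /Rintegral integral0.
have SE s : (\sum_(0 <= k < n.+1) d k * s `^ (g k - 1)) / (z - s) `^ alpha =
    (\sum_(0 <= k < n) d k * s `^ (g k - 1)) / (z - s) `^ alpha
      + d n * (s `^ (g n - 1) * (z - s) `^ (1 - alpha - 1)).
  by rewrite big_nat_recr//= mulrDl -mulrA kE.
have ipow := integrable_power_kernel (g0 n) a1' z0.
have idpow : mu.-integrable `]0, z[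
    (fun s => (d n * (s `^ (g n - 1) * (z - s) `^ (1 - alpha - 1)))%:E).
  by apply: eq_integrable (integrableZl _ (d n) ipow) => // s _; rewrite EFinM.
split.
  by apply: eq_integrable (integrableD _ IHi idpow) => // s _; rewrite SE EFinD.
under eq_Rintegral => s _ do rewrite SE.
rewrite RintegralD// IHe RintegralZl// big_nat_recr//= mulrDr; congr (_ + _).
rewrite /Rintegral integral_power_kernel//= /Beta.
rewrite (_ : g n + (1 - alpha) - 1 = g n - alpha); last by ring.
rewrite (_ : g n + (1 - alpha) = g n + 1 - alpha); last by ring.
ring.
Qed.

Lemma caputo_powsum alpha z n (d g : nat -> R) f : 0 < alpha < 1 -> 0 < z ->
  (forall k, 0 < g k) ->
  (forall s, 0 < s < z -> derive1 f s = \sum_(0 <= k < n) d k * s `^ (g k - 1)) ->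
  caputo alpha f z = \sum_(0 <= k < n)
    d k * (Gamma (g k) / Gamma (g k + 1 - alpha) * z `^ (g k - alpha)).
Proof.
move=> a01 z0 g0 fE; rewrite /caputo.
have [_ h] := integral_powsum n d a01 z0 g0.
rewrite (@eq_Rintegral _ _ _ mu _
  (fun s => (\sum_(0 <= k < n) d k * s `^ (g k - 1)) / (z - s) `^ alpha)).
  rewrite h mulKf// gt_eqF// Gamma_gt0// subr_gt0.
  by case/andP: a01.
by move=> s; rewrite inE/= in_itv/= => sz; rewrite fE.
Qed.

(** The Caputo derivative sees [f] only through its derivative on [`]0, z[];
    hence the hypothesis on positive arguments and the absence of [c] from the
    result. *)
Lemma caputo_two_powers alpha c a b f z : 0 < alpha < 1 -> 0 < z ->
  (forall s, 0 < s -> f s = c + a * s `^ alpha + b * s `^ (2 * alpha)) ->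
  caputo alpha f z =
    a * Gamma (1 + alpha) + b * (Gamma (1 + 2 * alpha) / Gamma (1 + alpha)) * z `^ alpha.
Proof.
move=> a01 z0 fE; have /andP[a0 a1] := a01.
have a20 : 0 < 2 * alpha by rewrite mulr_gt0.
rewrite (@caputo_powsum _ _ 2 (nth 0 [:: a * alpha; b * (2 * alpha)])
  (nth 1 [:: alpha; 2 * alpha]))//.
- rewrite !big_nat_recl// big_nil/= addr0 subrr powRr0.
  rewrite (_ : alpha + 1 - alpha = 1); last by ring.
  rewrite (_ : 2 * alpha + 1 - alpha = 1 + alpha); last by ring.
  rewrite (_ : 2 * alpha - alpha = alpha); last by ring.
  rewrite Gamma1 (GammaS a0) (GammaS a20).
  have : Gamma alpha != 0 by rewrite gt_eqF// Gamma_gt0.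
  move: (Gamma alpha) (Gamma (2 * alpha)) (z `^ alpha) => G1 G2 w G10.
  by field; rewrite G10 gt_eqF.
- by case=> [|[|k]] //=; rewrite nth_nil.
move=> s /andP[s0 _].
rewrite !big_nat_recl// big_nil/= addr0 -!mulrA derive1E.
have h1 := is_derive1_powR alpha s0.
have h2 := is_derive1_powR (2 * alpha) s0.
have h : is_derive s 1 (fun s => c + a * s `^ alpha + b * s `^ (2 * alpha))
  (0 + a * (alpha * s `^ (alpha - 1)) + b * (2 * alpha * s `^ (2 * alpha - 1))).
  by apply: is_deriveD.
rewrite add0r -mulrA in h.
rewrite -(@derive_val _ _ _ _ _ _ _ h); apply: near_eq_derive.
by near=> y; apply: fE; near: y; exact: lt_nbhsr.
Unshelve. all: by end_near. Qed.

(** The partial sums [F n] of the differentiated series are sums of powers, whose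
    integrals are known.  The identity [a * Gamma a = Gamma (1 + a)] at
    [a = alpha * (k + 1)] cancels the factor coming from the derivative and
    shifts the index by one, so the original series reappears, multiplied by
    [- rho].  Integrability is recorded separately because the positivity of the
    Mittag-Leffler function uses it. *)
Lemma ml_kernel_integral alpha rho z : 0 < alpha < 1 -> 0 < z -> 0 < rho ->
  mu.-integrable `]0, z[ (fun s =>
     (ml_powR_deriv alpha rho s / (z - s) `^ alpha)%:E)
  /\ \int[mu]_(s in `]0, z[)
     (ml_powR_deriv alpha rho s / (z - s) `^ alpha)
   = Gamma (1 - alpha) * (- rho * mittag_leffler alpha (- rho * z `^ alpha)).
Proof.
move=> a01 z0 r0; have /andP[a0 a1] := a01.
have a1' : 0 < 1 - alpha by rewrite subr_gt0.
pose c := ml_coeff alpha.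
have ec : entire (pseries_diffs c) by apply: entire_diffs; exact: entire_ml.
pose d k := pseries_diffs c k * (- rho) ^+ k.+1 * alpha.
pose g k : R := alpha * k.+1%:R.
have g0 k : 0 < g k by rewrite mulr_gt0.
pose F n s := (\sum_(0 <= k < n) d k * s `^ (g k - 1)) / (z - s) `^ alpha.
have powk k x : x `^ (alpha * k%:R) = (x `^ alpha) ^+ k.
  by rewrite powRrM powR_mulrn ?powR_ge0.
have FE n s : 0 < s -> F n s = pseries (pseries_diffs c) (- rho * s `^ alpha) n *
    (- rho * (alpha * s `^ (alpha - 1))) / (z - s) `^ alpha.
  move=> s0; rewrite /F /pseries /series /= [in RHS]mulr_suml; congr (_ / _).
  apply: eq_bigr => k _; rewrite /d exprMn exprS.
  rewrite (_ : g k - 1 = alpha * k%:R + (alpha - 1)); last by rewrite /g; ring.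
  rewrite (@powRD _ s (alpha * k%:R)); last by rewrite (gt_eqF s0) implybT.
  by rewrite powk; ring.
(* On ]0, z[ the argument of the series is at most rho * z `^ alpha in absolute
   value, so the normed series at that point bounds all partial sums. *)
pose C := limn (pseries (fun k => `|pseries_diffs c k|) (rho * z `^ alpha)).
have FC n s : 0 < s < z -> `|F n s| <=
    C * rho * alpha * (s `^ (alpha - 1) * (z - s) `^ (1 - alpha - 1)).
  move=> /andP[s0 sz]; rewrite FE// -mulrA normrM.
  rewrite (_ : 1 - alpha - 1 = - alpha); last by ring.
  rewrite powRN -!mulrA.
  rewrite [X in _ * X](_ : _ =
    rho * (alpha * (s `^ (alpha - 1) / (z - s) `^ alpha))); last first.
    by rewrite !normrM normrN normfV !ger0_norm ?powR_ge0// ?ltW// !mulrA.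
  rewrite ler_wpM2r ?mulr_ge0 ?invr_ge0 ?powR_ge0 ?(ltW r0) ?(ltW a0)//.
  have eabs : cvgn (pseries (fun k => `|pseries_diffs c k|) (rho * z `^ alpha)).
    exact: entire_normed.
  have rz0 : 0 <= rho * z `^ alpha by rewrite mulr_ge0 ?powR_ge0// ltW.
  apply: le_trans (nondecreasing_cvgn_le _ eabs n); last first.
    by apply: nondecreasing_series => k _ _; rewrite mulr_ge0// exprn_ge0.
  rewrite /pseries /series/= (le_trans (ler_norm_sum _ _ _))// ler_sum// => k _.
  rewrite normrM normrX ler_wpM2l// lerXn2r ?nnegrE//.
  rewrite normrM normrN !ger0_norm ?powR_ge0 ?(ltW r0)//.
  rewrite ler_wpM2l ?(ltW r0)// ge0_ler_powR ?nnegrE//; exact: ltW.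
have iF n := (integral_powsum n d a01 z0 g0).1.
pose f s := ml_powR_deriv alpha rho s / (z - s) `^ alpha.
have Ff s : 0 < s -> F ^~ s @ \oo --> f s.
  move=> s0; under eq_fun do rewrite FE//.
  apply: cvgM; last exact: cvg_cst.
  by apply: cvgM; [exact: ec|exact: cvg_cst].
have mF n : measurable_fun `]0, z[ (fun s => (F n s)%:E) by have /measurable_int := iF n.
have mf : measurable_fun `]0, z[ (EFin \o f).
  apply: (emeasurable_fun_cvg (fun n s => (F n s)%:E)) => //.
  move=> s; rewrite /= in_itv/= => /andP[s0 _].
  by apply: cvg_EFin; [exact: nearW|exact: Ff].
have := @dominated_convergence _ _ R mu `]0, z[ _ (fun n s => (F n s)%:E) (EFin \o f)
  (fun s => (C * rho * alpha * (s `^ (alpha - 1) * (z - s) `^ (1 - alpha - 1)))%:E).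
case => //.
- apply/aeW => s; rewrite /= in_itv/= => /andP[s0 _].
  by apply: cvg_EFin; [exact: nearW|exact: Ff].
- have ik := integrable_power_kernel a0 a1' z0.
  by apply: eq_integrable (integrableZl _ (C * rho * alpha) ik) => // s _; rewrite EFinM.
- by apply/aeW => s n; rewrite /= in_itv/= => s0; rewrite lee_fin FC.
move=> i_f _ cvg_int; split => //.
have {}cvg_int : (fun n => \int[mu]_(s in `]0, z[) F n s) @ \oo -->
    \int[mu]_(s in `]0, z[) f s.
  apply: fine_cvg; rewrite fineK//; exact: integrable_fin_num.
have intE : (fun n => \int[mu]_(s in `]0, z[) F n s) =
    (fun n => Gamma (1 - alpha) * \sum_(0 <= k < n)
      d k * (Gamma (g k) / Gamma (g k + 1 - alpha) * z `^ (g k - alpha))).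
  by apply/funext => n; exact: (integral_powsum n d a01 z0 g0).2.
rewrite intE in cvg_int.
apply: (cvg_unique _ cvg_int) => //.
apply: cvgM; first exact: cvg_cst.
rewrite [X in X @ \oo --> _](_ : _ = fun n => - rho * pseries c (- rho * z `^ alpha) n).
  by apply: cvgM; [exact: cvg_cst|rewrite mittag_lefflerE; exact: entire_ml].
apply/funext => n; rewrite /pseries /series /= mulr_sumr; apply: eq_bigr => k _.
rewrite /d /pseries_diffs /c /ml_coeff.
rewrite (_ : alpha * k.+1%:R = g k)// GammaS// exprMn exprS.
rewrite (_ : g k - alpha = alpha * k%:R) ?powk; last by rewrite /g; ring.
rewrite (_ : g k + 1 - alpha = 1 + alpha * k%:R); last by rewrite /g; ring.
have gG : Gamma (g k) != 0 by rewrite gt_eqF// Gamma_gt0.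
have gG' : Gamma (1 + alpha * k%:R) != 0.
  by rewrite gt_eqF// Gamma_gt0// ltr_wpDr// mulr_ge0// ltW.
move: (Gamma (g k)) gG => G gG; rewrite /g; field.
by rewrite gG gG' (gt_eqF a0) nat1r pnatr_eq0.
Qed.

Lemma caputo_ml alpha rho c z : 0 < alpha < 1 -> 0 < z -> 0 < rho ->
  caputo alpha (fun s => c * mittag_leffler alpha (- rho * s `^ alpha)) z
  = - rho * (c * mittag_leffler alpha (- rho * z `^ alpha)).
Proof.
move=> a01 z0 r0; have /andP[a0 a1] := a01.
have [i e] := ml_kernel_integral a01 z0 r0.
rewrite /caputo.
rewrite (@eq_Rintegral _ _ _ mu _
  (fun s => c * (ml_powR_deriv alpha rho s / (z - s) `^ alpha))); last first.
  move=> s; rewrite inE/= in_itv/= => /andP[s0 _]; rewrite mulrA; congr (_ / _).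
  have h := is_derive_ml_powR rho a0 s0.
  rewrite derive1E.
  have h' := is_deriveZ c h.
  exact: (@derive_val _ _ _ _ _ _ _ h').
rewrite RintegralZl// e.
have : Gamma (1 - alpha) != 0 by rewrite gt_eqF// Gamma_gt0// subr_gt0.
by move=> G0; field.
Qed.

End Caputo.

(** * Positivity of the Mittag-Leffler function on the negative axis *)

Section Positivity.
Local Open Scope classical_set_scope.
Local Open Scope ring_scope.
Context {R : realType}.
Local Notation mu := (@lebesgue_measure R).
Implicit Types (alpha rho s x z : R).

(** Dominated convergence for the restrictions of [f] to the [F n]. *)
Lemma cvg_Rintegral_exhaustion (D : set R) (F : (set R)^nat) (f : R -> R) :
  measurable D -> (forall n, measurable (F n)) -> (forall n, F n `<=` D) ->
  (forall s, D s -> \forall n \near \oo, F n s) ->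
  mu.-integrable D (EFin \o f) ->
  \int[mu]_(s in F n) f s @[n --> \oo] --> \int[mu]_(s in D) f s.
Proof.
move=> mD mF FD DF intf.
have mf := measurable_int _ intf.
have [] := @dominated_convergence _ _ R mu D mD (fun n => (EFin \o f) \_ (F n))
  (EFin \o f) (fun s => `|(EFin \o f) s|%E).
- move=> n; apply/measurable_restrict; do ?[exact: mF | exact: mD].
  exact: (measurable_funS mD (@subIsetl _ _ _) mf).
- exact: mf.
- apply/aeW => s Ds; apply: cvg_near_cst; have := DF s Ds.
  by apply: filterS => n Fn; rewrite patchE mem_set.
- exact: integrable_abse.
- apply/aeW => s n Ds; rewrite patchE; case: ifPn => // _.
  by rewrite abse0.
move=> _ _; rewrite /Rintegral => h; apply: fine_cvg.
rewrite fineK; last exact: integrable_fin_num.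
apply: cvg_trans h; apply: near_eq_cvg; apply: nearW => n.
by rewrite -[in RHS](setIidr (FD n)) integral_mkcondr.
Qed.

(** On a closed subinterval of [`]0, 1[] the product rule gives
    [v' s / (1 - s) `^ alpha <= p^`() s] for [p s := v s * (1 - s) `^ (- alpha)],
    since [v] is nonnegative and the kernel increases.  Integrate over
    [[u n, 1 - u n]]: at the left end [p] tends to [v0], and at the right end to
    [0] because [v] vanishes to first order at [1] while [alpha < 1].  Stopping
    short of both ends is necessary, as [v'] may be singular at [0] and the
    kernel is singular at [1]. *)
Lemma extremum_principle alpha (v v' : R -> R) (v0 : R) : 0 < alpha < 1 ->
  (forall s, 0 < s -> is_derive s 1 v (v' s)) ->
  (forall s, 0 < s -> {for s, continuous v'}) ->
  v s @[s --> 0^'+] --> v0 -> v 1 = 0 -> (forall s, 0 < s < 1 -> 0 <= v s) ->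
  mu.-integrable `]0, 1[ (fun s => (v' s / (1 - s) `^ alpha)%:E) ->
  \int[mu]_(s in `]0, 1[) (v' s / (1 - s) `^ alpha) <= - v0.
Proof.
move=> /andP[a0 a1] dv cv' vv0 v10 v_ge0 intf.
pose u (n : nat) : R := (n.+3%:R)^-1.
have u0 n : 0 < u n by rewrite invr_gt0.
have u_lt n : u n < 1 - u n.
  have : u n <= 3^-1 by rewrite lef_pV2 ?posrE// ler_nat.
  by have := u0 n; lra.
have cvu : u n @[n --> \oo] --> (0 : R).
  by have := @cvg_harmonic R; rewrite -cvg_shiftS -cvg_shiftS.
pose k s : R := (1 - s) `^ (- alpha).
pose p s := v s * k s.
pose p' s := v' s * k s + v s * (alpha * (1 - s) `^ (- alpha - 1)).
have dk s : s < 1 -> is_derive s 1 k (alpha * (1 - s) `^ (- alpha - 1)).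
  move=> s1; have s10 : 0 < 1 - s by rewrite subr_gt0.
  have h := is_derive1_powR (- alpha) s10.
  have h' : is_derive s 1 (fun s => 1 - s) (- 1).
    by rewrite -[- 1]add0r; apply: is_deriveB.
  have := @is_derive1_comp _ (fun x => x `^ (- alpha)) (fun s => 1 - s) s _ _ h h'.
  by rewrite mulrN1 mulNr opprK.
have dp s : 0 < s < 1 -> is_derive s 1 p (p' s).
  move=> /andP[s0 s1]; have hv := dv s s0; have hk := dk s s1.
  have -> : p' s = v s *: (alpha * (1 - s) `^ (- alpha - 1)) + k s *: v' s.
    by rewrite /p' addrC [v' s * _]mulrC.
  exact: is_deriveM.
have c1s s : {for s, continuous (fun s : R => 1 - s)}.
  by apply: continuousB; [exact: cvg_cst|exact: cvg_id].
have cp' s : 0 < s < 1 -> {for s, continuous p'}.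
  move=> s01; have /andP[s0 s1] := s01; have s10 : 0 < 1 - s by rewrite subr_gt0.
  have cv : {for s, continuous v}.
    by apply/differentiable_continuous/derivable1_diffP; have [] := dv s s0.
  have cpow b : {for s, continuous (fun s => (1 - s) `^ b)}.
    apply: (@continuous_comp _ _ _ (fun s => 1 - s) (fun x => x `^ b)) => //.
    exact: continuous_powR.
  apply: continuousD; first by apply: continuousM; [exact: cv'|exact: cpow].
  by apply: continuousM => //; apply: continuousM; [exact: cvg_cst|exact: cpow].
pose F n : set R := `[u n, 1 - u n]%classic.
have F01 n s : F n s -> 0 < s < 1.
  by rewrite /F/= in_itv/=; have := u0 n; lra.
have FTC n : (\int[mu]_(s in F n) (p' s)%:E = (p (1 - u n))%:E - (p (u n))%:E)%E.
  have cp s : 0 < s < 1 -> {for s, continuous p}.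
    by move=> /dp[dps _]; apply/differentiable_continuous/derivable1_diffP.
  have un := u0 n; have uln := u_lt n.
  apply: (@continuous_FTC2 _ p' p) => //.
  - by apply: continuous_in_subspaceT => s; rewrite inE => /F01; exact: cp'.
  - split.
    + move=> s; rewrite in_itv/= => sI; have s01 : 0 < s < 1 by lra.
      by have [] := dp s s01.
    + by apply: cvg_at_right_filter; apply: cp; lra.
    + by apply: cvg_at_left_filter; apply: cp; lra.
  - move=> s; rewrite in_itv/= => sI; rewrite derive1E.
    have h : is_derive s 1 p (p' s) by apply: dp; lra.
    exact: (@derive_val _ _ _ _ _ _ _ h).
have intp' n : mu.-integrable (F n) (EFin \o p').
  apply: continuous_compact_integrable; first exact: segment_compact.
  by apply: continuous_in_subspaceT => s; rewrite inE => /F01; exact: cp'.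
have FTC_le n : \int[mu]_(s in F n) (v' s / (1 - s) `^ alpha) <= p (1 - u n) - p (u n).
  have -> : p (1 - u n) - p (u n) = \int[mu]_(s in F n) p' s by rewrite /Rintegral FTC.
  apply: le_Rintegral => //.
  - by rewrite /F; exact: measurable_itv.
  - apply: integrableS intf => //; first by rewrite /F; exact: measurable_itv.
    by move=> s /F01; rewrite /= in_itv.
  - move=> s /F01 s01; rewrite /p' /k powRN lerDl mulr_ge0 ?v_ge0//.
    by rewrite mulr_ge0 ?powR_ge0//; exact: ltW.
have lim_int : \int[mu]_(s in F n) (v' s / (1 - s) `^ alpha) @[n --> \oo] -->
    \int[mu]_(s in `]0, 1[) (v' s / (1 - s) `^ alpha).
  apply: cvg_Rintegral_exhaustion => //.
  - by move=> n; rewrite /F; exact: measurable_itv.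
  - move=> s; rewrite /= in_itv/= => /andP[s0 s1].
    have m0 : 0 < Num.min s (1 - s) by rewrite lt_min s0 subr_gt0.
    near=> n.
    have : u n < Num.min s (1 - s).
      near: n; have /cvgrPdist_lt /(_ _ m0) := cvu.
      by apply: filterS => n; rewrite sub0r normrN gtr0_norm.
    by rewrite lt_min /F/= in_itv/=; lra.
have lim0 : p (u n) @[n --> \oo] --> v0.
  rewrite -[v0]mulr1; apply: cvgM.
    by have /cvg_at_rightP := vv0; apply; split.
  have : k (u n) @[n --> \oo] --> k 0.
    apply: (@cvg_comp _ _ _ u k) cvu _.
    apply: (@continuous_comp _ _ _ (fun s => 1 - s) (fun x => x `^ (- alpha))) => //.
    by apply: continuous_powR; rewrite subr0.
  by rewrite /k subr0 powR1.
(* p (1 - u n) is the difference quotient of v at 1, up to sign, multiplied by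
   u n `^ (1 - alpha). *)
have lim1 : p (1 - u n) @[n --> \oo] --> (0 : R).
  have dv1 : (- u n)^-1 *: (v (- u n *: 1 + 1) - v 1) @[n --> \oo] --> v' 1.
    have [+ <-] := dv 1 ltr01.
    move=> /cvgr_dnbhsP; apply; split; first by move=> n; rewrite oppr_eq0 gt_eqF.
    by rewrite -oppr0; exact: cvgN.
  have upow : (u n) `^ (1 - alpha) @[n --> \oo] --> (0 : R).
    have a1' : 0 < 1 - alpha by rewrite subr_gt0.
    by have /cvg_at_rightP := powR_cvg0 a1'; apply; split.
  have : - ((- u n)^-1 *: (v (- u n *: 1 + 1) - v 1)) * (u n) `^ (1 - alpha)
      @[n --> \oo] --> - v' 1 * 0.
    by apply: cvgM => //; exact: cvgN.
  rewrite mulr0; apply: cvg_trans; apply: near_eq_cvg; apply: nearW => n.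
  rewrite v10 subr0 /p /k (_ : 1 - (1 - u n) = u n); last by ring.
  rewrite /GRing.scale/= (_ : - u n * 1 + 1 = 1 - u n); last by ring.
  rewrite powRD; last by rewrite (gt_eqF (u0 n)) implybT.
  rewrite powRr1 ?(ltW (u0 n))//; have un0 : u n != 0 by rewrite gt_eqF.
  by field; rewrite un0.
rewrite -[- v0]add0r.
apply: (ler_cvg_to lim_int (cvgB lim1 lim0)).
exact: nearW.
Unshelve. all: by end_near. Qed.

(** The extremum principle is applied to [mittag_leffler alpha (- x1 * s `^ alpha)]
    minus its minimum: scaling by [x1] puts the minimum point at [s = 1]. *)
Lemma ml_gt0 alpha x : 0 < alpha < 1 -> 0 <= x -> 0 < mittag_leffler alpha (- x).
Proof.
move=> a01 x0; have /andP[a0 a1] := a01.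
have cml : continuous (mittag_leffler alpha : R -> R).
  move=> w; apply/differentiable_continuous/derivable1_diffP.
  by have [] := is_derive_ml w a0.
rewrite ltNge; apply/negP => mlx.
have [x1 x1I x1min] := @EVT_min R (fun w => mittag_leffler alpha (- w)) _ _ x0
  (continuous_subspaceT (fun w => continuous_comp (opp_continuous w) (cml _))).
pose m := mittag_leffler alpha (- x1).
have m0 : m <= 0 by apply: le_trans mlx; apply: x1min; rewrite in_itv/= x0 lexx.
have x10 : 0 < x1.
  move: x1I; rewrite in_itv/= => /andP[]; rewrite le_eqVlt => /predU1P[x10|//] _.
  by move: m0; rewrite /m -x10 oppr0 ml0// leNgt ltr01.
have [inth inte] := ml_kernel_integral a01 ltr01 x10.
have : \int[mu]_(s in `]0, 1[) (ml_powR_deriv alpha x1 s / (1 - s) `^ alpha)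
    <= - (1 - m).
  apply: (@extremum_principle _
    (fun s => mittag_leffler alpha (- x1 * s `^ alpha) - m)) => //.
  - move=> s s0; have h := is_derive_ml_powR x1 a0 s0.
    by rewrite -[X in is_derive _ _ _ X]subr0; exact: is_deriveB.
  - move=> s s0.
    have cpow b : {for s, continuous (fun x : R => x `^ b)} by exact: continuous_powR.
    have cM b (h : R -> R) : {for s, continuous h} ->
        {for s, continuous (fun x => b * h x)}.
      by move=> ch; apply: continuousM => //; exact: cvg_cst.
    apply: continuousM; last exact: (cM _ _ (cM _ _ (cpow _))).
    apply: (@continuous_comp _ _ _ (fun s => - x1 * s `^ alpha) (ml_deriv alpha)).
      exact: (cM _ _ (cpow _)).
    apply/differentiable_continuous/derivable1_diffP.
    by have [] := entire_derive (- x1 * s `^ alpha) (entire_diffs (entire_ml a0)).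
  - apply: cvgB; last exact: cvg_cst.
    rewrite -(ml0 a0); apply: (@continuous_cvg _ _ _ _ _ _ (mittag_leffler alpha)).
      exact: cml.
    rewrite -[X in _ --> X](mulr0 (- x1)); apply: cvgM; first exact: cvg_cst.
    exact: powR_cvg0.
  - by rewrite powR1 mulr1 subrr.
  - move=> s /andP[s0 s1]; rewrite subr_ge0 mulNr; apply: x1min.
    have : s `^ alpha <= 1 `^ alpha by apply: ge0_ler_powR; rewrite ?nnegrE ltW.
    rewrite powR1 => sa.
    move: x1I; rewrite !in_itv/= => /andP[_ x1x].
    rewrite mulr_ge0 ?powR_ge0 ?(ltW x10)//=.
    by rewrite (le_trans _ x1x)// ler_piMr// ltW.
rewrite inte powR1 mulr1 -/m leNgt => /negP; apply.
have G0 : 0 < Gamma (1 - alpha) by rewrite Gamma_gt0// subr_gt0.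
apply: (@lt_le_trans _ _ 0); first lra.
by rewrite mulr_ge0 ?(ltW G0)// mulNr -mulrN mulr_ge0 ?(ltW x10)// oppr_ge0.
Qed.

End Positivity.

(** * The Euler-Lagrange equation *)

Theorem proposition6 (R : realType) (alpha rho a1 a2 a3 : R)
    (L1 : R -> R -> R) (L : R -> R -> R -> R) :
  0 < alpha < 1 -> 0 < rho ->
  (forall x y : R, L1 x y =
     - a1 * y `^ (2 * alpha) - a2 * y `^ alpha * x `^ alpha
     - a3 * x `^ (2 * alpha)) ->
  (forall t x y : R, L t x y = L1 x y * mittag_leffler alpha (- rho * t `^ alpha)) ->
  forall t x y y2 : R, 0 < t -> 0 < x -> 0 < y ->
    euler_lagrange alpha L t x y y2 = 0 <->
    a1 * Gamma (1 + alpha) * Gamma (1 + 2 * alpha) * y2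
    - (a2 * Gamma (1 + alpha) ^+ 2 + rho * a1 * Gamma (1 + 2 * alpha))
      * y `^ alpha
    + a2 * Gamma (1 + alpha) ^+ 3 * y
    - (a3 * Gamma (1 + 2 * alpha) + rho * a2 * Gamma (1 + alpha) ^+ 2)
      * x `^ alpha = 0.
Proof.
move=> a01 rho0 L1E LE t x y y2 t0 x0 y0; have /andP[a0 a1'] := a01.
(* M, G1 and G2 are abstract so that the ring and field computations treat them
   as atoms. *)
have [M ME] : {M : R -> R | forall s, mittag_leffler alpha (- rho * s `^ alpha) = M s}.
  by exists (fun s => mittag_leffler alpha (- rho * s `^ alpha)).
have M0 : M t != 0 by rewrite gt_eqF// -ME mulNr ml_gt0// mulr_ge0 ?powR_ge0// ltW.
have G1_neq0 : Gamma (1 + alpha) != 0 by rewrite gt_eqF// Gamma_gt0// addr_gt0.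
have [G1 G1E] : {G | Gamma (1 + alpha) = G} by exists (Gamma (1 + alpha)).
have [G2 G2E] : {G | Gamma (1 + 2 * alpha) = G} by exists (Gamma (1 + 2 * alpha)).
rewrite !G1E G2E; rewrite G1E in G1_neq0.
have DxL : caputo_x alpha L t x y =
    (- a2 * y `^ alpha * G1 - a3 * (G2 / G1) * x `^ alpha) * M t.
  rewrite /caputo_x (@caputo_two_powers _ _ (- a1 * y `^ (2 * alpha) * M t)
    (- a2 * y `^ alpha * M t) (- a3 * M t))//; first by rewrite G1E G2E; ring.
  by move=> s _; rewrite LE L1E ME; ring.
have DyL s u v : 0 < v -> caputo_y alpha L s u v =
    (- a2 * u `^ alpha * G1 - a1 * (G2 / G1) * v `^ alpha) * M s.
  move=> v0; rewrite /caputo_y (@caputo_two_powers _ _ (- a3 * u `^ (2 * alpha) * M s)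
    (- a2 * u `^ alpha * M s) (- a1 * M s))//; first by rewrite G1E G2E; ring.
  by move=> w _; rewrite LE L1E ME; ring.
have DtDyL : caputo_t alpha (caputo_y alpha L) t x y =
    - rho * ((- a2 * x `^ alpha * G1 - a1 * (G2 / G1) * y `^ alpha) * M t).
  have := caputo_ml (- a2 * x `^ alpha * G1 - a1 * (G2 / G1) * y `^ alpha) a01 t0 rho0.
  rewrite ME => <-.
  apply: (congr1 (fun h => caputo alpha h t)).
  by apply/funext => s; rewrite DyL// ME.
have DxDyL : caputo_x alpha (caputo_y alpha L) t x y = - a2 * G1 * M t * G1.
  rewrite /caputo_x (@caputo_two_powers _ _ (- a1 * (G2 / G1) * y `^ alpha * M t)
    (- a2 * G1 * M t) 0)//; first by rewrite !G1E; ring.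
  by move=> s _; rewrite DyL//; ring.
have DyDyL : caputo_y alpha (caputo_y alpha L) t x y = - a1 * (G2 / G1) * M t * G1.
  rewrite {1}/caputo_y (@caputo_two_powers _ _ (- a2 * x `^ alpha * G1 * M t)
    (- a1 * (G2 / G1) * M t) 0)//; first by rewrite !G1E; ring.
  by move=> s s0; rewrite DyL//; ring.
rewrite /euler_lagrange /total_caputo DxL DtDyL DxDyL DyDyL.
set P := (X in _ <-> X = 0).
rewrite [X in X = 0 <-> _](_ : _ = M t / G1 * P); last by rewrite /P; field.
split=> [/eqP|->]; last by rewrite mulr0.
by rewrite !mulf_eq0 invr_eq0 (negPf M0) (negPf G1_neq0) => /eqP.
Qed.
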